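(* Let $\mathcal{X}$ be a real Banach space with $\dim\mathcal{X}\ge2$, let $p>1$, $\mathcal{F}=\frac1p\|\cdot\|^p$, let $j_p$ be a selection of the duality mapping $J_p$ of $\mathcal{X}$, and let $\phi:[0,\infty)\to[0,\infty)$ be nondecreasing. Let $V=(\mathcal{X}\setminus\{0\})\times\mathcal{X}$ and consider the statements: (a) There exist $C,c>0$ such that for all $(x,y)\in V$ with $\|x-y\|\le c\|x\|$: $\ \Delta_{\mathcal{F}}^{j_p(x)}(y,x)\le C\|x\|^p\,\phi\!\left(\frac{\|x-y\|}{\|x\|}\right)$. (b) There exists $C>0$ such that for all $(x,y)\in V$: $\ \Delta_{\mathcal{F}}^{\mathrm{sym}}(x,y)\le C\max\{\|x\|,\|y\|\}^p\,\phi\!\left(\frac{2\|x-y\|}{\max\{\|x\|,\|y\|\}}\right)$. (c) There exists $C>0$ such that for all $(x,y)\in V$: $\ \Delta_{\mathcal{F}}^{j_p(x)}(y,x)\le C\max\{\|x\|,\|y\|\}^p\,\phi\!\left(\frac{2\|x-y\|}{\max\{\|x\|,\|y\|\}}\right)$. Then (a) implies (b), and (b) implies (c). Moreover, (c) implies the statement (a) with $\phi$ replaced by the function $t\mapsto\phi(2t)$.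
   Context: Duality mapping: $J_p(x)=\{x^*\in\mathcal{X}^*:\langle x^*,x\rangle=\|x^*\|\|x\|,\ \|x^*\|=\|x\|^{p-1}\}$; a selection $j_p:\mathcal{X}\to\mathcal{X}^*$ satisfies $j_p(x)\in J_p(x)$ for all $x$. Bregman divergence: $\Delta_{\mathcal{F}}^{\xi}(y,x)=\mathcal{F}(y)-\mathcal{F}(x)-\langle\xi,y-x\rangle$. Symmetric Bregman divergence: $\Delta_{\mathcal{F}}^{\mathrm{sym}}(x,y)=\Delta_{\mathcal{F}}^{j_p(x)}(y,x)+\Delta_{\mathcal{F}}^{j_p(y)}(x,y)=\langle j_p(x)-j_p(y),x-y\rangle$. *)

(* Defs.v *)
From HB Require Import structures.
From mathcomp Require Import all_boot all_order all_algebra.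
From mathcomp Require Import all_classical all_reals all_analysis.
Set Implicit Arguments.
Unset Strict Implicit.
Unset Printing Implicit Defensive.
Import Order.TTheory GRing.Theory Num.Theory.
Import numFieldNormedType.Exports.
Local Open Scope classical_set_scope.
Local Open Scope ring_scope.

Definition dim_ge2 (R : realType) (X : normedModType R) : Prop :=
  exists u v : X, forall a b : R, a *: u + b *: v = 0 -> a = 0 /\ b = 0.

(* The scalars are written R^o so that they form a normed module over R. *)
Record dual (R : realType) (X : normedModType R) := Dual {
  dual_fun :> {linear X -> R^o};
  dual_continuous : continuous dual_fun }.

(* The set below is nonempty and, by continuity of xi, bounded, so that this
   is a genuine supremum and not the default value of sup. *)
Definition dual_norm (R : realType) (X : normedModType R) (xi : dual X) : R :=
  sup [set `|xi x : R| | x in [set x : X | `|x| <= 1]].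

Definition duality_mapping (R : realType) (X : normedModType R) (p : R)
    (x : X) : set (dual X) :=
  [set xi : dual X | (xi x : R) = dual_norm xi * `|x| /\
            dual_norm xi = `|x| `^ (p - 1)].

Definition duality_selection (R : realType) (X : normedModType R) (p : R)
    (j : X -> dual X) : Prop :=
  forall x, duality_mapping p x (j x).

Definition bregman (R : realType) (X : normedModType R) (F : X -> R)
    (xi : dual X) (y x : X) : R :=
  F y - F x - xi (y - x).

Definition norm_power (R : realType) (X : normedModType R) (p : R) (x : X) : R :=
  p^-1 * `|x| `^ p.

Definition bregman_sym (R : realType) (X : normedModType R) (F : X -> R)
    (j : X -> dual X) (x y : X) : R :=
  bregman F (j x) y x + bregman F (j y) x y.

Lemma bregman_symE (R : realType) (X : normedModType R) (F : X -> R)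
    (j : X -> dual X) (x y : X) :
  bregman_sym F j x y = j x (x - y) - j y (x - y).
Proof.
rewrite /bregman_sym /bregman -(opprB x y) (linearN (j x)) /=.
by rewrite opprK addrACA -(opprB (F y) (F x)) subrr add0r.
Qed.

(* A function from [0, oo) to [0, oo) is represented by a function R -> R,
   only the values of which on [0, oo) are constrained. *)
Definition nondecreasing_gauge (R : realType) (phi : R -> R) : Prop :=
  (forall t, 0 <= t -> 0 <= phi t) /\
  (forall s t, 0 <= s -> s <= t -> phi s <= phi t).

Definition local_bregman_bound (R : realType) (X : normedModType R) (p : R)
    (j : X -> dual X) (phi : R -> R) : Prop :=
  exists C c : R, [/\ 0 < C, 0 < c &
    forall x y : X, x != 0 -> `|x - y| <= c * `|x| ->
      bregman (norm_power p) (j x) y x <=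
        C * `|x| `^ p * phi (`|x - y| / `|x|)].

Definition global_sym_bregman_bound (R : realType) (X : normedModType R)
    (p : R) (j : X -> dual X) (phi : R -> R) : Prop :=
  exists2 C : R, 0 < C &
    forall x y : X, x != 0 ->
      bregman_sym (norm_power p) j x y <=
        C * Num.max `|x| `|y| `^ p *
          phi (2 * `|x - y| / Num.max `|x| `|y|).

Definition global_bregman_bound (R : realType) (X : normedModType R)
    (p : R) (j : X -> dual X) (phi : R -> R) : Prop :=
  exists2 C : R, 0 < C &
    forall x y : X, x != 0 ->
      bregman (norm_power p) (j x) y x <=
        C * Num.max `|x| `|y| `^ p *
          phi (2 * `|x - y| / Num.max `|x| `|y|).

(* Main.v *)
Require Import Defs.
From mathcomp Require Import all_boot all_order all_algebra.
From mathcomp Require Import all_classical all_reals all_analysis.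
From mathcomp Require Import ring lra.
Set Implicit Arguments.
Unset Strict Implicit.
Unset Printing Implicit Defensive.
Import Order.TTheory GRing.Theory Num.Theory.
Import numFieldNormedType.Exports.
Local Open Scope classical_set_scope.
Local Open Scope ring_scope.

(* For (a) => (b), let |y| <= |x| and d = |x - y| / |x|.  If d is below a
   threshold c1, then |y| >= |x| / 2 and (a) applies to both (x, y) and (y, x).
   If d > c1, then the symmetric divergence is at most 4 |x|^p, so it suffices
   that phi (2 d) >= phi c1 > 0; this positivity comes from (a) applied in the
   radial direction y = (1 + c1) x, where the divergence is a positive multiple
   of |x|^p by the strict Bernoulli inequality.  (b) => (c) holds because the
   Bregman divergence is nonnegative (Young), and (c) => (a) because
   |x| <= max(|x|, |y|) <= 2 |x| whenever |x - y| <= |x|. *)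

(** Write [b ^ p] as [b * expR ((p - 1) * ln b)]. Since [ln b] is nonzero, [1 + u < expR u] is
    strict at [u = (p - 1) * ln b], and [b * ln b >= b - 1] finishes. *)
Lemma bernoulli_powR_lt (R : realType) (p b : R) :
  1 < p -> 0 < b -> b != 1 -> 1 + p * (b - 1) < b `^ p.
Proof.
move=> p1 b0 b1.
have lnb : ln b != 0 by rewrite ln_eq0.
have bln : b - 1 <= b * ln b.
  (* The bound [ln (1 + u) <= u] at [u = b^-1 - 1] bounds [ln b] from below. *)
  have : ln (1 + (b^-1 - 1)) <= b^-1 - 1.
    by apply: le_ln1Dx; rewrite ltrBrDl subrr invr_gt0.
  rewrite addrC subrK lnV ?posrE // -(ler_pM2l b0) mulrBr divff ?gt_eqF //; lra.
have p1b : b * (1 + (p - 1) * ln b) < b * b `^ (p - 1).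
  by rewrite ltr_pM2l // /powR (gt_eqF b0) expR_gt1Dx // mulf_neq0 // subr_eq0 gt_eqF.
rewrite -(mulr_powRB1 (ltW b0)); last lra.
apply: le_lt_trans p1b; nra.
Qed.

(** Young's inequality for [a] and [b ^ (p - 1)] with conjugate exponents [p] and [p / (p - 1)]. *)
Lemma young_powR (R : realType) (p a b : R) : 1 < p -> 0 <= a -> 0 <= b ->
  b `^ (p - 1) * a <= p^-1 * a `^ p + (1 - p^-1) * b `^ p.
Proof.
move=> p1 a0 b0.
have p0 : 0 < p by lra.
have pm1 : 0 < p - 1 by lra.
have pn0 : p != 0 by rewrite gt_eqF.
have pm1n0 : p - 1 != 0 by rewrite gt_eqF.
have conj : p^-1 + (p / (p - 1))^-1 = 1 by field; apply/andP; split.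
have := conjugate_powR a0 (powR_ge0 b (p - 1)) p0 (divr_gt0 p0 pm1) conj.
have -> : (p / (p - 1))^-1 = 1 - p^-1 by field; apply/andP; split.
rewrite -powRrM mulrCA divff // mulr1; lra.
Qed.

Lemma dual_norm_bound (R : realType) (X : normedModType R) (xi : dual X) (x : X) :
  `|xi x : R| <= dual_norm xi * `|x|.
Proof.
have [->|x0] := eqVneq x 0; first by rewrite linear0 !normr0 mulr0.
have nx0 : 0 < `|x| by rewrite normr_gt0.
have nxV : 0 <= `|x|^-1 by rewrite invr_ge0 ltW.
rewrite -ler_pdivrMr //; apply: ub_le_sup; last first.
  exists (`|x|^-1 *: x) => /=.
    by rewrite normrZ ger0_norm // mulVf ?gt_eqF.
  by rewrite linearZ /= normrM ger0_norm // mulrC.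
(* Continuity bounds [xi] on the unit ball, so the supremum is a true upper bound. *)
have [M xiM] :=
  (bounded_funP _).2 ((linear_bounded_continuous _).2 (@dual_continuous _ _ xi)) 1.
by exists M => _ [z /= z1 <-]; exact: xiM.
Qed.

Section DualitySelection.
Context (R : realType) (X : normedModType R) (p : R) (j : X -> dual X).
Hypotheses (hp : 1 < p) (hj : duality_selection p j).

Let p_gt0 : 0 < p := lt_trans ltr01 hp.
Let pm1_ge0 : 0 <= p - 1.
Proof. by rewrite subr_ge0 ltW. Qed.

Lemma selection_diag x : j x x = `|x| `^ p :> R.
Proof.
by have [-> ->] := hj x; rewrite mulrC mulr_powRB1.
Qed.

Lemma selection_le x y : `|j x y : R| <= `|x| `^ (p - 1) * `|y|.
Proof. by have [_ <-] := hj x; exact: dual_norm_bound. Qed.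

(** Since [j x x = |x| ^ p], the divergence is the right side of [young_powR] at [a = |y|],
    [b = |x|], minus [j x y], which is at most the left side. *)
Lemma bregman_norm_power_ge0 x y : 0 <= bregman (norm_power p) (j x) y x.
Proof.
rewrite /bregman /norm_power linearB /= selection_diag.
have := young_powR hp (normr_ge0 y) (normr_ge0 x).
have := le_trans (ler_norm _) (selection_le x y).
by move=> /le_trans h /h; lra.
Qed.

Lemma bregman_sym_norm_powerC x y :
  bregman_sym (norm_power p) j x y = bregman_sym (norm_power p) j y x.
Proof. by rewrite /bregman_sym addrC. Qed.

Lemma bregman_norm_power_radial x (t : R) : 0 <= t ->
  bregman (norm_power p) (j x) ((1 + t) *: x) x =
  (p^-1 * ((1 + t) `^ p - 1) - t) * `|x| `^ p.
Proof.
move=> t0; rewrite /bregman /norm_power.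
have -> : (1 + t) *: x - x = t *: x.
  by rewrite scalerDl scale1r addrAC subrr add0r.
rewrite normrZ ger0_norm ?addr_ge0 // powRM ?addr_ge0 //.
have -> : j x (t *: x) = t * `|x| `^ p :> R.
  by rewrite linearZ /= selection_diag.
ring.
Qed.

(** Both functionals have norm at most [|x| ^ (p - 1)] and are evaluated at a vector of norm at most
    [2 * |x|]. *)
Lemma bregman_sym_norm_power_le x y : `|y| <= `|x| ->
  bregman_sym (norm_power p) j x y <= 4 * `|x| `^ p.
Proof.
move=> yx; rewrite bregman_symE.
have xy : `|x - y| <= 2 * `|x| by have := ler_normB x y; lra.
have xx : `|x| `^ (p - 1) * `|x| = `|x| `^ p by rewrite mulrC mulr_powRB1.
have h z : `|z| <= `|x| -> `|j z (x - y) : R| <= 2 * `|x| `^ p.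
  move=> zx; apply: le_trans (selection_le _ _) _; rewrite -xx mulrCA.
  apply: ler_pM; rewrite ?powR_ge0 //.
  by apply: ge0_ler_powR; rewrite ?nnegrE.
have hx : (j x (x - y) : R) <= 2 * `|x| `^ p.
  by apply: le_trans (ler_norm _) (h _ _).
have hy : - (j y (x - y) : R) <= 2 * `|x| `^ p.
  by rewrite (le_trans _ (h _ yx)) // -normrN ler_norm.
by apply: le_trans (lerD hx hy) _; rewrite -mulrDl -natrD.
Qed.

Context (phi : R -> R).
Hypothesis hphi : nondecreasing_gauge phi.

(** At [y = (1 + c) x] the hypothesis becomes [p^-1 * ((1 + c) ^ p - 1) - c <= C * phi c], with
    positive left side by strict Bernoulli. *)
Lemma local_bound_gauge_gt0 (x : X) (C c : R) : x != 0 -> 0 < C -> 0 < c ->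
  (forall y, `|x - y| <= c * `|x| -> bregman (norm_power p) (j x) y x <=
     C * `|x| `^ p * phi (`|x - y| / `|x|)) ->
  0 < phi c.
Proof.
move=> x0 C0 c0 /(_ ((1 + c) *: x)).
have nx0 : 0 < `|x| by rewrite normr_gt0.
have -> : `|x - (1 + c) *: x| = c * `|x|.
  by rewrite scalerDl scale1r opprD addrA subrr add0r normrN normrZ gtr0_norm.
rewrite mulfK ?gt_eqF // bregman_norm_power_radial ?(ltW c0) // => /(_ (lexx _)).
rewrite mulrAC ler_pM2r ?powR_gt0 // => h.
rewrite -(pmulr_rgt0 _ C0); apply: lt_le_trans h.
have : 1 + p * (1 + c - 1) < (1 + c) `^ p.
  by apply: bernoulli_powR_lt => //; [lra | rewrite gt_eqF //; lra].
rewrite addrAC subrr add0r -ltrBrDl mulrC -ltr_pdivlMr //.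
by rewrite mulrC subr_gt0.
Qed.

Lemma local_bregman_bound_global_sym :
  local_bregman_bound p j phi -> global_sym_bregman_bound p j phi.
Proof.
case=> C [c [C0 c0 hC]]; have [phi_ge0 phi_le] := hphi.
(* The bound [1 / 2] gives [|x| <= 2 |y|]; the bound [c / 2] then keeps [|x - y| <= c |y|] after the
   roles are swapped. *)
pose c1 := Num.min (c / 2) (1 / 2).
have c10 : 0 < c1 by rewrite lt_min; apply/andP; split; lra.
have [c1c c12] : c1 <= c / 2 /\ c1 <= 1 / 2.
  by split; rewrite /c1 ge_min lexx ?orbT.
(* Positivity of [phi c1] needs a nonzero vector, not yet at hand; if [phi c1] were 0, the quotient
   would be 0 by convention. *)
have phic1 : 0 <= 4 / phi c1 by rewrite divr_ge0 // phi_ge0 // ltW.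
(* By symmetry the maximum may be taken to be [|x|]. The constant adds [2 * C] for near points and
   [4 / phi c1] for far ones. *)
suff key (x y : X) : x != 0 -> `|y| <= `|x| ->
    bregman_sym (norm_power p) j x y <=
      (2 * C + 4 / phi c1) * `|x| `^ p * phi (2 * `|x - y| / `|x|).
  exists (2 * C + 4 / phi c1); first lra.
  move=> x y x0; have [xy|yx] := ltP `|x| `|y|; last exact: key.
  have y0 : y != 0 by rewrite -normr_gt0 (le_lt_trans _ xy).
  by rewrite bregman_sym_norm_powerC distrC key // ltW.
move=> x0 yx; have nx0 : 0 < `|x| by rewrite normr_gt0.
have xp0 : 0 < `|x| `^ p by rewrite powR_gt0.
have d2 : `|x - y| / `|x| <= 2 * `|x - y| / `|x|.
  by rewrite ler_pM2r ?invr_gt0 //; have := normr_ge0 (x - y); lra.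
have d0 : 0 <= `|x - y| / `|x| by rewrite divr_ge0.
have ph0 : 0 <= phi (2 * `|x - y| / `|x|) by exact/phi_ge0/(le_trans d0).
have [xy|xy] := leP `|x - y| (c1 * `|x|).
  have xyc : `|x - y| <= c / 2 * `|x| by rewrite (le_trans xy) // ler_pM2r.
  have xy2 : `|x - y| <= 1 / 2 * `|x| by rewrite (le_trans xy) // ler_pM2r.
  have xy_y : `|x| <= 2 * `|y|.
    by have := lerB_dist x y; lra.
  have ny0 : 0 < `|y| by lra.
  have bx : bregman (norm_power p) (j x) y x <=
      C * `|x| `^ p * phi (2 * `|x - y| / `|x|).
    apply: le_trans (hC x y x0 _) _; first nra.
    by rewrite ler_wpM2l ?mulr_ge0 ?powR_ge0 ?(ltW C0) // phi_le.
  have by_ : bregman (norm_power p) (j y) x y <=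
      C * `|x| `^ p * phi (2 * `|x - y| / `|x|).
    have yxy : `|y - x| <= c * `|y| by rewrite distrC; nra.
    apply: le_trans (hC y x _ yxy) _; first by rewrite -normr_gt0.
    rewrite distrC ler_pM ?mulr_ge0 ?powR_ge0 ?phi_ge0 ?divr_ge0 ?(ltW C0) //.
      by rewrite ler_pM2l // ge0_ler_powR ?nnegrE // ltW.
    (* The factor 2 inside [phi] pays for replacing [|y|] by [|x|], as [|x| <= 2 |y|]. *)
    apply: phi_le; first by rewrite divr_ge0.
    rewrite ler_pdivrMr // mulrAC ler_pdivlMr //.
    by have := normr_ge0 (x - y); nra.
  have := mulr_ge0 phic1 (mulr_ge0 (ltW xp0) ph0).
  by rewrite /bregman_sym; lra.
have phic1_gt0 : 0 < phi c1.
  apply: (@local_bound_gauge_gt0 x C c1) => // z xz.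
  by apply: hC => //; nra.
apply: le_trans (bregman_sym_norm_power_le yx) _.
have phic : phi c1 <= phi (2 * `|x - y| / `|x|).
  by apply: phi_le; [exact: ltW | rewrite (le_trans _ d2) // ler_pdivlMr // ltW].
have : 4 * `|x| `^ p <= 4 / phi c1 * `|x| `^ p * phi (2 * `|x - y| / `|x|).
  rewrite (mulrAC 4) -[leRHS]mulrA ler_peMr ?mulr_ge0 ?(ltW xp0) //.
  by rewrite mulrC ler_pdivlMr ?mul1r.
have := mulr_ge0 (ltW C0) (mulr_ge0 (ltW xp0) ph0).
lra.
Qed.

Lemma global_sym_bregman_bound_global :
  global_sym_bregman_bound p j phi -> global_bregman_bound p j phi.
Proof.
case=> C C0 hC; exists C => // x y x0; apply: le_trans (hC x y x0).
by rewrite /bregman_sym lerDl bregman_norm_power_ge0.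
Qed.

Lemma global_bregman_bound_local :
  global_bregman_bound p j phi -> local_bregman_bound p j (fun t => phi (2 * t)).
Proof.
case=> C C0 hC; have [phi_ge0 phi_le] := hphi.
(* Radius 1 forces the maximum below [2 * |x|], and [2 ^ p] absorbs this in the power; inside [phi]
   only [|x| <= max] is used. *)
exists (C * 2 `^ p), 1; split; rewrite ?mulr_gt0 ?powR_gt0 //.
move=> x y x0; rewrite mul1r => xy; apply: le_trans (hC x y x0) _.
have nx0 : 0 < `|x| by rewrite normr_gt0.
have xM : `|x| <= Num.max `|x| `|y| by rewrite le_max lexx.
have M0 : 0 < Num.max `|x| `|y| by rewrite (lt_le_trans nx0).
have M2 : Num.max `|x| `|y| <= 2 * `|x|.
  by rewrite ge_max; have := lerB_dist y x; rewrite distrC => ?; apply/andP; lra.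
have d0 : 0 <= 2 * `|x - y| by rewrite mulr_ge0.
rewrite mulrA ler_pM ?mulr_ge0 ?powR_ge0 ?phi_ge0 ?divr_ge0 ?(ltW C0) ?(ltW M0) //.
  rewrite -mulrA ler_pM2l // -powRM //.
  by apply: ge0_ler_powR; rewrite ?nnegrE ?mulr_ge0 // ltW.
apply: phi_le; first by rewrite divr_ge0 // ltW.
by rewrite ler_wpM2l // lef_pV2 ?posrE.
Qed.

End DualitySelection.

Theorem proposition4p3 (R : realType) (X : completeNormedModType R)
    (hX : dim_ge2 X) (p : R) (hp : 1 < p)
    (j : X -> dual X) (hj : duality_selection p j)
    (phi : R -> R) (hphi : nondecreasing_gauge phi) :
  [/\ local_bregman_bound p j phi -> global_sym_bregman_bound p j phi,
      global_sym_bregman_bound p j phi -> global_bregman_bound p j phi &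
      global_bregman_bound p j phi ->
        local_bregman_bound p j (fun t => phi (2 * t))].
Proof.
split.
- exact: local_bregman_bound_global_sym.
- exact: global_sym_bregman_bound_global.
- exact: global_bregman_bound_local.
Qed.
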